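(* Suppose $E:\mathcal{P}_{2,\omega_0}(\mathbb{R}^d)\to\mathbb{R}\cup\{+\infty\}$ is proper, coercive, lower semicontinuous and $\lambda$-convex along generalized geodesics for some $\lambda\in\mathbb{R}$. Let $\mu\in D(|\partial E|)$ and let $h_1,h_2,\dots$ and $\tau$ satisfy $0<h_i\le\tau<\frac1{\lambda^-}$. Write $J^m=J_{h_m}\circ\cdots\circ J_{h_1}\mu$ (with $J^0=\mu$), $J^n=J^n_\tau\mu$, and $P_m=\prod_{k=1}^m(1-\lambda^-h_k)^{-1}$. Then for $n,m\ge1$, $$(1-\lambda^-h_m)^2W_2^2(J^n,J^m)\le\frac{h_m}{\tau}(1-\lambda^-\tau)^{-1}W_2^2(J^{n-1},J^{m-1})+\frac{\tau-h_m}{\tau}W_2^2(J^{m-1},J^n)+2h_m^2P_m^2|\partial E|^2(\mu).$$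
   Context: Fix a probability measure $\omega_0$ on $\mathbb{R}^d$. $W_2$ is the quadratic Wasserstein distance, $\Gamma_0$ the optimal couplings; $\mathcal{P}_{2,\omega_0}(\mathbb{R}^d)=\{\mu:W_2(\mu,\omega_0)<\infty\}$. A transport plan from $\mu_0$ to $\mu_1$ with base $\omega$ is $\boldsymbol\omega\in\mathcal{P}((\mathbb{R}^d)^3)$ with $\pi^{1,2}\#\boldsymbol\omega\in\Gamma_0(\omega,\mu_0)$, $\pi^{1,3}\#\boldsymbol\omega\in\Gamma_0(\omega,\mu_1)$; generalized geodesic $\mu_\alpha=((1-\alpha)\pi^2+\alpha\pi^3)\#\boldsymbol\omega$; $W_{2,\boldsymbol\omega}(\mu_0,\mu_1)=(\int|x_2-x_3|^2d\boldsymbol\omega)^{1/2}$. $D(E)=\{E<\infty\}$; proper: $D(E)\ne\emptyset$; coercive: $\exists\tau_0>0,u_0$ with $\inf_v\{\frac1{2\tau_0}W_2^2(u_0,v)+E(v)\}>-\infty$; lower semicontinuous w.r.t. $W_2$; $\lambda$-convex along generalized geodesics: for all $\mu_0,\mu_1,\omega$ there is a generalized geodesic from $\mu_0$ to $\mu_1$ with base $\omega$ (induced by some $\boldsymbol\omega$) with $E(\mu_\alpha)\le(1-\alpha)E(\mu_0)+\alpha E(\mu_1)-\alpha(1-\alpha)\frac\lambda2W^2_{2,\boldsymbol\omega}(\mu_0,\mu_1)$. $\lambda^-=\max\{0,-\lambda\}$, $1/\lambda^-=+\infty$ if $\lambda^-=0$. $J_\tau\mu=\operatorname{argmin}_\nu\{\frac1{2\tau}W_2^2(\mu,\nu)+E(\nu)\}$,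 $J^n_\tau$ its $n$-fold iterate. Metric slope $|\partial E|(\mu)=\limsup_{\nu\to\mu}(E(\mu)-E(\nu))^+/W_2(\mu,\nu)$; $D(|\partial E|)=\{\mu\in D(E):|\partial E|(\mu)<\infty\}$. *)

(* Defs.v *)
From HB Require Import structures.
From mathcomp Require Import all_boot all_order all_algebra.
From mathcomp Require Import all_classical all_reals all_analysis.
Set Implicit Arguments. Unset Strict Implicit. Unset Printing Implicit Defensive.
Import Order.TTheory GRing.Theory Num.Theory numFieldNormedType.Exports.
Local Open Scope classical_set_scope.
Local Open Scope ring_scope.

Section Wasserstein.
Variables (R : realType) (d : nat).

(* R^d = d.-tuple R with the product (= Borel) sigma-algebra of the library *)
Definition Rd := d.-tuple R.

Definition sqdist (x y : Rd) : R := \sum_(i < d) (tnth x i - tnth y i) ^+ 2.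

Definition lincomb (a : R) (x y : Rd) : Rd :=
  [tuple (1 - a) * tnth x i + a * tnth y i | i < d].

Definition coupling (mu nu : probability Rd R) (g : probability (Rd * Rd)%type R) : Prop :=
  (forall A : set Rd, measurable A -> g (fst @^-1` A) = mu A) /\
  (forall A : set Rd, measurable A -> g (snd @^-1` A) = nu A).

Definition cost (g : probability (Rd * Rd)%type R) : \bar R :=
  (\int[g]_z (sqdist z.1 z.2)%:E)%E.

Definition W2sq (mu nu : probability Rd R) : \bar R :=
  ereal_inf [set c | exists g, coupling mu nu g /\ c = cost g].

(* W_2 itself (used only between elements of P_{2,omega0}, where W2sq is finite) *)
Definition W2 (mu nu : probability Rd R) : R := Num.sqrt (fine (W2sq mu nu)).

Definition optimal_coupling (mu nu : probability Rd R) (g : probability (Rd * Rd)%type R) :=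
  coupling mu nu g /\ cost g = W2sq mu nu.

Definition P2 (w0 mu : probability Rd R) : Prop := (W2sq mu w0 < +oo)%E.

Definition transport_plan (om mu0 mu1 : probability Rd R)
  (p : probability ((Rd * Rd) * Rd)%type R) : Prop :=
  (exists g : probability (Rd * Rd)%type R, optimal_coupling om mu0 g /\
     forall A : set (Rd * Rd), measurable A -> g A = p (fst @^-1` A)) /\
  (exists g : probability (Rd * Rd)%type R, optimal_coupling om mu1 g /\
     forall A : set (Rd * Rd), measurable A ->
       g A = p ((fun z : (Rd * Rd) * Rd => (z.1.1, z.2)) @^-1` A)).

Definition is_gen_geodesic_point (p : probability ((Rd * Rd) * Rd)%type R) (a : R)
  (nu : probability Rd R) : Prop :=
  forall A : set Rd, measurable A ->
    nu A = p ((fun z : (Rd * Rd) * Rd => lincomb a z.1.2 z.2) @^-1` A).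

Definition W2plan_sq (p : probability ((Rd * Rd) * Rd)%type R) : \bar R :=
  (\int[p]_z (sqdist z.1.2 z.2)%:E)%E.

Section Energy.
Variables (w0 : probability Rd R) (E : probability Rd R -> \bar R).

Definition no_minus_infty : Prop := forall mu, P2 w0 mu -> E mu != -oo%E.

Definition E_proper : Prop := exists mu, P2 w0 mu /\ (E mu < +oo)%E.

Definition coercive : Prop :=
  exists tau0 : R, 0 < tau0 /\ exists u0, P2 w0 u0 /\
    (-oo < ereal_inf [set (((2 * tau0)^-1)%:E * W2sq u0 v + E v)%E | v in P2 w0])%E.

Definition W2_lsc : Prop :=
  forall (s : nat -> probability Rd R) (mu : probability Rd R),
    P2 w0 mu -> (forall k, P2 w0 (s k)) ->
    W2 (s k) mu @[k --> \oo] --> (0 : R) ->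
    (E mu <= limn_einf (fun k => E (s k)))%E.

Definition convex_gen_geod (lam : R) : Prop :=
  forall mu0 mu1 om, P2 w0 mu0 -> P2 w0 mu1 -> P2 w0 om ->
  exists p, transport_plan om mu0 mu1 p /\
    forall a : R, 0 <= a <= 1 -> forall nu, is_gen_geodesic_point p a nu ->
      (E nu <= (1 - a)%:E * E mu0 + a%:E * E mu1
               - (a * (1 - a) * lam / 2)%:E * W2plan_sq p)%E.

Definition is_JKO_step (tau : R) (mu nu : probability Rd R) : Prop :=
  P2 w0 nu /\ forall v, P2 w0 v ->
    (((2 * tau)^-1)%:E * W2sq mu nu + E nu <= ((2 * tau)^-1)%:E * W2sq mu v + E v)%E.

Definition slope (mu : probability Rd R) : \bar R :=
  ereal_inf [set ereal_sup [set (Order.max (E mu - E nu) 0%E * (W2 mu nu)^-1%:E)%E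
                           | nu in [set nu | P2 w0 nu /\ 0 < W2 mu nu < delta]]
            | delta in [set delta : R | 0 < delta]].

Definition in_dom_slope (mu : probability Rd R) : Prop :=
  P2 w0 mu /\ (E mu < +oo)%E /\ (slope mu < +oo)%E.

End Energy.
End Wasserstein.

Definition lam_minus {R : realType} (lam : R) : R := Num.max 0 (- lam).

(* Main.v *)
Require Import Defs.
From HB Require Import structures.
From mathcomp Require Import all_boot all_order all_algebra.
From mathcomp Require Import all_classical all_reals all_analysis.
From mathcomp Require Import measurable_realfun ring lra.
Import Order.TTheory GRing.Theory Num.Theory numFieldNormedType.Exports.
Local Open Scope classical_set_scope.
Local Open Scope ring_scope.

(* Let l = lam^-. Comparing J = J_tau mu with the generalized geodesic of base mu
   from J to nu gives the discrete variational inequality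
     (1 - l tau) W2^2(J, nu) <= W2^2(mu, nu) - W2^2(mu, J) + 2 tau (E nu - E J).
   Write A' = J^(n-1), A = J^n, B' = J^(m-1), B = J^m and h = h_m. Adding (1 - l h)
   times this inequality for (B', B) tested at A and h / tau times the one for (A', A)
   tested at B' leaves the energy differences E B' - E B and E B' - E A. Both are
   controlled by E B' - E v <= s W2(B', v) + (l / 2) W2^2(B', v) with
   s = P_(m-1) |dE|(mu): this bound holds at mu by convexity along geodesics, and each
   step J_h divides the constant s by 1 - l h. Completing squares and using the
   triangle inequality for A', A, B' finishes the proof.

   The convexity hypothesis itself provides transport plans with a given base, hence the
   triangle inequality on P_(2,w0) without a gluing lemma. The only other place where
   measures must be glued is to see that generalized geodesics stay in P_(2,w0); there a
   crude gluing along the cells of the unit grid suffices. *)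

(** * Pushforwards and integrals against marginals *)

Lemma probability_of_measure {dT : measure_display} {T : measurableType dT}
    {R : realType} (m : {measure set T -> \bar R}) :
  m setT = 1%E -> exists P : probability T R, P = m :> (set T -> \bar R).
Proof.
(* [mnormalize] falls back on the Dirac mass only for total mass 0 or infinity, which [m1]
   excludes. *)
move=> m1; exists (mnormalize m (dirac (point : T))).
by apply/funext => A; rewrite /= /mnormalize m1 onee_eq0 /= invr1 mule1.
Qed.

Section Pushforward.
Context {d1 d2 : measure_display} {T1 : measurableType d1} {T2 : measurableType d2}.
Context {R : realType}.

Lemma pushforward_probability (P : probability T1 R) (f : T1 -> T2) :
  measurable_fun setT f ->
  exists Q : probability T2 R, forall A, measurable A -> Q A = P (f @^-1` A).
Proof.
move=> mf.
pose X : {mfun T1 >-> T2} := HB.pack f (isMeasurableFun.Build _ _ _ _ _ mf).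
by exists (distribution P X).
Qed.

Lemma integral_marginal (P : {measure set T1 -> \bar R})
    (Q : {measure set T2 -> \bar R}) (f : T1 -> T2) (g : T2 -> \bar R) :
  measurable_fun setT f -> (forall A, measurable A -> Q A = P (f @^-1` A)) ->
  measurable_fun setT g -> (forall y, 0 <= g y)%E ->
  (\int[Q]_y g y = \int[P]_x g (f x))%E.
Proof.
move=> mf QP mg g0.
rewrite (eq_measure_integral (pushforward P f)); last by move=> A mA _; rewrite QP.
by rewrite (ge0_integral_pushforward mf) ?preimage_setT// => y _.
Qed.

End Pushforward.

(** * Gluing along equally distributed countable labels *)

Section CountableCoupling.
Context {d1 d2 : measure_display} {T1 : measurableType d1} {T2 : measurableType d2}.
Context {R : realType} (P1 : probability T1 R) (P2 : probability T2 R).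
Variables (c1 : T1 -> nat) (c2 : T2 -> nat).
Hypothesis mc1 : forall k, measurable (c1 @^-1` [set k]).
Hypothesis mc2 : forall k, measurable (c2 @^-1` [set k]).
Hypothesis c12 : forall k, P1 (c1 @^-1` [set k]) = P2 (c2 @^-1` [set k]).

Let D k : set (T1 * T2) := (c1 @^-1` [set k]) `*` (c2 @^-1` [set k]).
Let mD k : measurable (D k). Proof. exact: measurableX. Qed.
Let w k : {nonneg R} := NngNum (fine_ge0 (measure_ge0 P1 (c1 @^-1` [set k]))).
Let winv k : {nonneg R} := ((w k)%:num^-1)%:nng.
(** Dividing the product measure on [D k] by the common mass of label [k] makes its marginals the
    restrictions of [P1] and [P2] to the fibres of [k]. A label of mass 0 gets weight [0^-1 = 0]. *)
Let sigma : {measure set (T1 * T2) -> \bar R} :=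
  mseries (fun k => mscale (winv k) (mrestr (P1 \x P2)%E (mD k))) 0.

Let wE k : P1 (c1 @^-1` [set k]) = (w k)%:num%:E.
Proof. by rewrite /= fineK// fin_num_measure. Qed.

Let sum_fibre {d} {T : measurableType d} (P : probability T R) (c : T -> nat)
    (mc : forall k, measurable (c @^-1` [set k])) (A : set T) : measurable A ->
  (\sum_(0 <= k <oo) P (A `&` c @^-1` [set k]) = P A)%E.
Proof.
move=> mA; rewrite -measure_semi_bigcup.
- congr (P _); rewrite -setI_bigcupr [X in _ `&` X](_ : _ = setT) ?setIT//.
  by rewrite -subTset => x _; exists (c x).
- by move=> k; exact: measurableI.
- by apply/trivIsetP => i j _ _ ij; apply/seteqP; split => // x [[_ /= ->] [_ /= /eqP]]; rewrite (negbTE ij).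
- by apply: bigcup_measurable => k _; exact: measurableI.
Qed.

(** The cancellation survives a label of mass 0, since [x] is then squeezed to 0. *)
Let weight_cancel (x : \bar R) k : (x <= P1 (c1 @^-1` [set k]))%E -> (0 <= x)%E ->
  ((winv k)%:num%:E * (x * P1 (c1 @^-1` [set k])) = x)%E.
Proof.
move=> xle x0; rewrite wE in xle *.
have xf : x \is a fin_num by rewrite ge0_fin_numE// (le_lt_trans xle)// ltry.
move: xle x0; rewrite -(fineK xf) !lee_fin => xle x0; congr EFin.
have [w0|w0] := eqVneq (w k)%:num 0.
  have -> : fine x = 0 by apply/eqP; rewrite eq_le x0 andbT -w0.
  by rewrite mul0r mulr0.
by rewrite mulrCA [in X in _ * X]/= mulVf ?mulr1.
Qed.

Let sigmaX A1 A2 : measurable A1 -> measurable A2 -> sigma (A1 `*` A2) =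
  (\sum_(0 <= k <oo) (winv k)%:num%:E *
     (P1 (A1 `&` c1 @^-1` [set k]) * P2 (A2 `&` c2 @^-1` [set k])))%E.
Proof.
move=> mA1 mA2; apply: eq_eseriesr => k _.
transitivity (
  ((winv k)%:num%:E * (P1 \x P2) ((A1 `&` c1 @^-1` [set k]) `*` (A2 `&` c2 @^-1` [set k])))%E).
  by rewrite setXI.
by rewrite product_measure1E//; exact: measurableI.
Qed.

Let sigma_fst A : measurable A -> sigma (A `*` setT) = P1 A.
Proof.
move=> mA; rewrite sigmaX// -[RHS](sum_fibre P1 c1)//; apply: eq_eseriesr => k _.
rewrite setTI -c12 weight_cancel//; apply: le_measure; rewrite ?inE//; exact: measurableI.
Qed.

Let sigma_snd A : measurable A -> sigma (setT `*` A) = P2 A.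
Proof.
move=> mA; rewrite sigmaX// -[RHS](sum_fibre P2 c2)//; apply: eq_eseriesr => k _.
rewrite setTI [in X in (_ * X)%E]muleC weight_cancel// c12.
by apply: le_measure; rewrite ?inE//; exact: measurableI.
Qed.

(* Given the common value k of the labels, the two coordinates are independent. *)
Lemma coupling_of_equal_labels :
  exists S : probability (T1 * T2)%type R,
    [/\ forall A, measurable A -> S (fst @^-1` A) = P1 A,
        forall A, measurable A -> S (snd @^-1` A) = P2 A &
        {ae S, forall z, c1 z.1 = c2 z.2}].
Proof.
have s1 : sigma setT = 1%E by rewrite -setXTT sigma_fst// probability_setT.
have [S SE] := probability_of_measure sigma s1; exists S; split.
- by move=> A mA; rewrite SE -setXT; exact: sigma_fst.
- by move=> A mA; rewrite SE -setTX; exact: sigma_snd.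
have mU : measurable (\bigcup_k D k) by exact: bigcup_measurable.
exists (~` \bigcup_k D k); split; first exact: measurableC.
- rewrite SE /= /mseries eseries0// => k _ _.
  transitivity ((winv k)%:num%:E * (P1 \x P2) ((~` \bigcup_k D k) `&` D k))%E => //.
  have -> : (~` \bigcup_k D k) `&` D k = set0.
    by apply/seteqP; split => // z [nU Dz]; apply: nU; exists k.
  by rewrite measure0 mule0.
- by move=> z /= cz [k _ [/= e1 e2]]; apply: cz; rewrite e1 e2.
Qed.

End CountableCoupling.

Lemma ge0_integral_lincomb {dT : measure_display} {T : measurableType dT} {R : realType}
    (P : {measure set T -> \bar R}) (u v : T -> R) (a b : R) :
  0 <= a -> 0 <= b -> (forall t, 0 <= u t) -> (forall t, 0 <= v t) ->
  measurable_fun setT u -> measurable_fun setT v ->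
  (\int[P]_t (a * u t + b * v t)%:E =
   a%:E * \int[P]_t (u t)%:E + b%:E * \int[P]_t (v t)%:E)%E.
Proof.
move=> a0 b0 u0 v0 mu mv.
have mue : measurable_fun setT (fun t => (u t)%:E) by exact/measurable_EFinP.
have mve : measurable_fun setT (fun t => (v t)%:E) by exact/measurable_EFinP.
under eq_integral do rewrite EFinD !EFinM.
rewrite ge0_integralD//.
- by rewrite !ge0_integralZl_EFin// => t _; rewrite lee_fin.
- by move=> t _; rewrite -EFinM lee_fin mulr_ge0.
- exact: measurable_funeM.
- by move=> t _; rewrite -EFinM lee_fin mulr_ge0.
- exact: measurable_funeM.
Qed.

(** * Squared Euclidean distance and the unit grid *)

Section SquaredDistance.
Context {R : realType} {d : nat}.
Implicit Types x y z : Rd R d.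

Lemma sqdist_ge0 x y : 0 <= sqdist x y.
Proof. by apply: sumr_ge0 => i _; exact: sqr_ge0. Qed.

Lemma sqdistC x y : sqdist x y = sqdist y x.
Proof. by apply: eq_bigr => i _; rewrite -[RHS]sqrrN opprB. Qed.

Lemma sqdistxx x : sqdist x x = 0.
Proof. by apply: big1 => i _; rewrite subrr expr0n. Qed.

Lemma tnth_lincomb a x y i : tnth (lincomb a x y) i = (1 - a) * tnth x i + a * tnth y i.
Proof. by rewrite tnth_mktuple. Qed.

(** Integrated over a plan with [x] at the base, this identity gives the convexity of the squared
    distance to the base along generalized geodesics. *)
Lemma sqdist_lincomb a x y z :
  sqdist x (lincomb a y z) + a * (1 - a) * sqdist y z =
  (1 - a) * sqdist x y + a * sqdist x z.
Proof.
rewrite !mulr_sumr -!big_split; apply: eq_bigr => i _ /=.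
by rewrite tnth_lincomb; ring.
Qed.

Lemma sqdist_lincombl a y z : sqdist y (lincomb a y z) = a ^+ 2 * sqdist y z.
Proof. by rewrite mulr_sumr; apply: eq_bigr => i _; rewrite tnth_lincomb; ring. Qed.

(** The free weight [t] survives integration; optimizing over it afterwards yields the triangle
    inequality for [W2] without Minkowski's inequality. *)
Lemma sqdist_young t x y z : 0 < t ->
  sqdist y z <= (1 + t) * sqdist x y + (1 + t^-1) * sqdist x z.
Proof.
move=> t0; rewrite !mulr_sumr -big_split; apply: ler_sum => i _ /=.
set p := tnth x i; set q := tnth y i; set r := tnth z i.
have -> : (1 + t) * (p - q) ^+ 2 + (1 + t^-1) * (p - r) ^+ 2 =
  (q - r) ^+ 2 + t^-1 * (t * (p - q) + (p - r)) ^+ 2 by field; rewrite gt_eqF.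
by rewrite lerDl mulr_ge0// ?sqr_ge0// invr_ge0 ltW.
Qed.

Lemma measurable_sqdist {dT : measure_display} {T : measurableType dT} (f g : T -> Rd R d) :
  measurable_fun setT f -> measurable_fun setT g ->
  measurable_fun setT (fun t => sqdist (f t) (g t)).
Proof.
move=> mf mg; apply: measurable_sum => i; apply: measurable_funX.
by apply: measurable_funB; apply: (measurableT_comp (measurable_tnth i)).
Qed.

Lemma measurable_lincomb {dT : measure_display} {T : measurableType dT} a (f g : T -> Rd R d) :
  measurable_fun setT f -> measurable_fun setT g ->
  measurable_fun setT (fun t => lincomb a (f t) (g t)).
Proof.
move=> mf mg; apply/measurable_fun_tnthP => i.
rewrite (_ : _ \o _ = (fun t => (1 - a) * tnth (f t) i + a * tnth (g t) i)); last first.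
  by apply/funext => t /=; rewrite tnth_lincomb.
by apply: measurable_funD; apply: measurable_funM => //;
  apply: (measurableT_comp (measurable_tnth i)).
Qed.

(** [pickle] turns the integer corner of the grid cell into a label in [nat], as the gluing
    requires. *)
Definition cell x : nat := pickle [tuple Num.floor (tnth x i) | i < d].

Lemma measurable_cell k : measurable (cell @^-1` [set k]).
Proof.
have [[x xk]|nx] := pselect (exists x, cell x = k); last first.
  rewrite [X in measurable X](_ : _ = set0)//.
  by apply/seteqP; split => // x xk; apply: nx; exists x.
rewrite [X in measurable X](_ : _ = \big[setI/setT]_(i < d)
   ((fun y : Rd R d => tnth y i) @^-1` `[(Num.floor (tnth x i))%:~R, (Num.floor (tnth x i) + 1)%:~R[ )).
  apply: bigsetI_measurable => i _.
  rewrite -[X in measurable X]setTI; apply: measurable_tnth => //.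
rewrite -bigcap_seq; apply/seteqP; split => y /=.
  rewrite -xk => /(pcan_inj pickleK) /(congr1 (fun t => tnth t)) e i _ /=.
  by move/(congr1 (fun t => t i)): e; rewrite !tnth_mktuple in_itv/= => <-; exact: floor_itv.
move=> yx; rewrite -xk; congr (pickle _); apply: eq_from_tnth => i; rewrite !tnth_mktuple.
apply: floor_def; have := yx i; rewrite /= in_itv/=; apply.
by rewrite mem_index_enum.
Qed.

Lemma sqdist_cell x y : cell x = cell y -> sqdist x y <= d%:R.
Proof.
move=> /(pcan_inj pickleK) e.
rewrite -[X in _ <= X%:R]card_ord -sum1_card natr_sum; apply: ler_sum => i _.
have ei : Num.floor (tnth x i) = Num.floor (tnth y i).
  by move/(congr1 (fun t => tnth t i)): e; rewrite !tnth_mktuple.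
have := floor_itv (tnth x i); have := floor_itv (tnth y i); rewrite ei intrD.
move=> /andP[y1 y2] /andP[x1 x2]; nra.
Qed.

End SquaredDistance.

(** * Wasserstein distance: symmetry and finiteness *)

Section Wasserstein.
Context {R : realType} {d : nat}.
Implicit Types mu nu om : probability (Rd R d) R.

Lemma cost_ge0 (g : probability (Rd R d * Rd R d)%type R) : (0 <= cost g)%E.
Proof. by apply: integral_ge0 => z _; rewrite lee_fin sqdist_ge0. Qed.

Lemma W2sq_ge0 mu nu : (0 <= W2sq mu nu)%E.
Proof. by apply: le_ereal_inf_tmp => _ [g [_ ->]]; exact: cost_ge0. Qed.

(** The joint law of [f] and [g] is a coupling. The probability space is left free so that triple
    plans and glued measures can serve directly. *)
Lemma W2sq_le {dT : measure_display} {T : measurableType dT} (P : probability T R)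
    (f g : T -> Rd R d) mu nu :
  measurable_fun setT f -> measurable_fun setT g ->
  (forall A, measurable A -> mu A = P (f @^-1` A)) ->
  (forall A, measurable A -> nu A = P (g @^-1` A)) ->
  (W2sq mu nu <= \int[P]_t (sqdist (f t) (g t))%:E)%E.
Proof.
move=> mf mg muE nuE.
have mfg : measurable_fun setT (fun t => (f t, g t)) by exact: measurable_fun_pair.
have [Q QE] := pushforward_probability P _ mfg.
apply: ereal_inf_lbound; exists Q; split.
  by split => A mA; rewrite QE// ?muE// ?nuE// -[X in measurable X]setTI;
     [exact: measurable_fst|exact: measurable_snd].
rewrite /cost (integral_marginal P Q _ _ mfg QE)//.
  by apply/measurable_EFinP; exact: measurable_sqdist.
by move=> z; rewrite lee_fin sqdist_ge0.
Qed.

Lemma coupling_marginals mu nu g : coupling mu nu g ->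
  (forall A, measurable A -> mu A = g (fst @^-1` A)) /\
  (forall A, measurable A -> nu A = g (snd @^-1` A)).
Proof. by move=> [g1 g2]; split => A mA; rewrite ?g1 ?g2. Qed.

Lemma W2sq_swap mu nu : (W2sq mu nu <= W2sq nu mu)%E.
Proof.
apply: le_ereal_inf_tmp => _ [g [/coupling_marginals[g1 g2] ->]].
apply: le_trans (W2sq_le g snd fst mu nu _ _ g2 g1) _ => //.
by under eq_integral do rewrite sqdistC.
Qed.

Lemma W2sqC mu nu : W2sq mu nu = W2sq nu mu.
Proof. by apply/eqP; rewrite eq_le !W2sq_swap. Qed.

Lemma W2sqxx mu : W2sq mu mu = 0%E.
Proof.
apply/eqP; rewrite eq_le W2sq_ge0 andbT.
have mid : measurable_fun setT (@idfun (Rd R d)) by exact: measurable_id.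
apply: le_trans (W2sq_le mu idfun idfun mu mu mid mid _ _) _ => //.
by rewrite integral0_eq// => t _; rewrite sqdistxx.
Qed.

(* Gluing along the cells of the unit grid instead of along points avoids
   disintegration, at the price of the additive constant [4 d]. *)
Lemma W2sq_lty_trans nu mu om :
  (W2sq mu nu < +oo)%E -> (W2sq nu om < +oo)%E -> (W2sq mu om < +oo)%E.
Proof.
move=> /ereal_inf_lt[_ [g [cg ->]] g_fin] /ereal_inf_lt[_ [g' [cg' ->]] g'_fin].
have [g1 g2] := coupling_marginals _ _ _ cg.
have [g'1 g'2] := coupling_marginals _ _ _ cg'.
have mcell k : measurable ((fun z : Rd R d * Rd R d => cell z.2) @^-1` [set k]).
  by rewrite -[X in measurable X]setTI; apply: (measurable_snd _ (cell @^-1` [set k])) => //; exact: measurable_cell.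
have mcell' k : measurable ((fun z : Rd R d * Rd R d => cell z.1) @^-1` [set k]).
  by rewrite -[X in measurable X]setTI; apply: (measurable_fst _ (cell @^-1` [set k])) => //; exact: measurable_cell.
have [|S [S1 S2 Scell]] := coupling_of_equal_labels g g' _ _ mcell mcell'.
  by move=> k; rewrite -(g2 (cell @^-1` [set k])) -?(g'1 (cell @^-1` [set k]))//; exact: measurable_cell.
pose u (z : (Rd R d * Rd R d) * (Rd R d * Rd R d)) := sqdist z.1.1 z.1.2.
pose v (z : (Rd R d * Rd R d) * (Rd R d * Rd R d)) := sqdist z.2.1 z.2.2.
have m11 : measurable_fun setT (fun z : (Rd R d * Rd R d) * (Rd R d * Rd R d) => z.1.1).
  by apply: (measurableT_comp measurable_fst).
have m12 : measurable_fun setT (fun z : (Rd R d * Rd R d) * (Rd R d * Rd R d) => z.1.2).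
  by apply: (measurableT_comp measurable_snd).
have m21 : measurable_fun setT (fun z : (Rd R d * Rd R d) * (Rd R d * Rd R d) => z.2.1).
  by apply: (measurableT_comp measurable_fst).
have m22 : measurable_fun setT (fun z : (Rd R d * Rd R d) * (Rd R d * Rd R d) => z.2.2).
  by apply: (measurableT_comp measurable_snd).
have mu' : measurable_fun setT u by exact: measurable_sqdist.
have mv : measurable_fun setT v by exact: measurable_sqdist.
have u0 z : 0 <= u z by exact: sqdist_ge0.
have v0 z : 0 <= v z by exact: sqdist_ge0.
have msq : measurable_fun setT (fun z : Rd R d * Rd R d => (sqdist z.1 z.2)%:E).
  by apply/measurable_EFinP; exact: measurable_sqdist.
apply: (@le_lt_trans _ _ (\int[S]_z (sqdist z.1.1 z.2.2)%:E)%E).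
  apply: W2sq_le => // A mA.
    by rewrite g1// -S1// -[X in measurable X]setTI; exact: measurable_fst.
  by rewrite g'2// -S2// -[X in measurable X]setTI; exact: measurable_snd.
(* Young's inequality with [t = 1] is used twice, through [z.1.2] and then [z.2.1]; these two points
   almost surely share a cell, so their squared distance is at most [d]. *)
apply: (@le_lt_trans _ _ (\int[S]_z (2 * u z + 4 * (v z + d%:R))%:E)%E).
  apply: ae_ge0_le_integral => //.
  - by move=> z _; rewrite lee_fin sqdist_ge0.
  - by apply/measurable_EFinP; exact: measurable_sqdist.
  - by move=> z _; rewrite lee_fin; have := u0 z; have := v0 z; have := ler0n R d; lra.
  - apply/measurable_EFinP; apply: measurable_funD; apply: measurable_funM => //.
    exact: measurable_funD.
  apply: filterS Scell => z /sqdist_cell zd _; rewrite lee_fin.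
  have := sqdist_young 1 z.1.2 z.1.1 z.2.2 ltr01.
  have := sqdist_young 1 z.2.1 z.1.2 z.2.2 ltr01.
  rewrite /u /v (sqdistC z.1.2 z.1.1) (sqdistC z.2.1 z.1.2) invr1.
  move: zd; lra.
rewrite ge0_integral_lincomb//; last 2 first.
  by move=> z; rewrite addr_ge0.
  exact: measurable_funD.
under [X in (_ + _ * X)%E]eq_integral do rewrite EFinD.
rewrite ge0_integralD//; last 2 first.
  by move=> z _; rewrite lee_fin.
  exact/measurable_EFinP.
have -> : (\int[S]_z (d%:R : R)%:E = (d%:R : R)%:E)%E.
  have := integral_cst S measurableT (d%:R : R)%:E; rewrite /cst => ->.
  by rewrite -[RHS]mule1; congr (_ * _)%E; exact: probability_setT.
rewrite -(integral_marginal S g fst _ measurable_fst (fun A mA => esym (S1 A mA)) msq); last first.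
  by move=> z; rewrite lee_fin sqdist_ge0.
rewrite -(integral_marginal S g' snd _ measurable_snd (fun A mA => esym (S2 A mA)) msq); last first.
  by move=> z; rewrite lee_fin sqdist_ge0.
by rewrite lte_add_pinfty// lte_mul_pinfty// lte_add_pinfty// ltry.
Qed.

End Wasserstein.

(** The optimal [t = b / a] degenerates when [a] or [b] is 0, so [t = (b + k) / (a + k)] is used,
    with [k] so small that the excess [2 * k * (a + b)] is below [e]. *)
Lemma le_sqrD_of_young {R : realType} (X a b : R) : 0 <= a -> 0 <= b ->
  (forall t, 0 < t -> X <= (1 + t) * a ^+ 2 + (1 + t^-1) * b ^+ 2) ->
  X <= (a + b) ^+ 2.
Proof.
move=> a0 b0 HX; apply/ler_addgt0Pr => e e0.
pose M := 4 * (a + b) + 4.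
have M0 : 0 < M by rewrite /M; lra.
pose k := Num.min 1 (e / M).
have k0 : 0 < k by rewrite /k lt_min ltr01 divr_gt0.
have k1 : k <= 1 by rewrite /k ge_min lexx.
have kM : k * M <= e by rewrite -ler_pdivlMr// /k ge_min lexx orbT.
have ak : 0 < a + k by lra.
have bk : 0 < b + k by lra.
have := HX _ (divr_gt0 bk ak); rewrite invf_div.
have -> : (1 + (b + k) / (a + k)) * a ^+ 2 + (1 + (a + k) / (b + k)) * b ^+ 2 =
  (a + b + 2 * k) * (a ^+ 2 / (a + k) + b ^+ 2 / (b + k)).
  by field; rewrite !gt_eqF.
have h1 : a ^+ 2 / (a + k) <= a by rewrite ler_pdivrMr//; nra.
have h2 : b ^+ 2 / (b + k) <= b by rewrite ler_pdivrMr//; nra.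
move=> HX'; apply: (le_trans HX'); apply: (@le_trans _ _ ((a + b + 2 * k) * (a + b))).
  by apply: ler_wpM2l; lra.
have : k * (a + b) <= k * M by apply: ler_wpM2l; [lra|rewrite /M; lra].
rewrite /M in kM *; nra.
Qed.

Lemma lam_minus_ge0 {R : realType} (lam : R) : 0 <= lam_minus lam.
Proof. by rewrite /lam_minus le_max lexx. Qed.

Lemma ge_lam_minus {R : realType} (lam : R) : - lam_minus lam <= lam.
Proof. by rewrite /lam_minus lerNl le_max lexx orbT. Qed.

(** * Transport plans and generalized geodesics *)

Section Plans.
Context {R : realType} {d : nat}.
Implicit Types mu nu om w : probability (Rd R d) R.

Lemma W2_ge0 mu nu : 0 <= W2 mu nu.
Proof. exact: sqrtr_ge0. Qed.

Lemma W2C mu nu : W2 mu nu = W2 nu mu.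
Proof. by rewrite /W2 W2sqC. Qed.

Lemma W2xx mu : W2 mu mu = 0.
Proof. by rewrite /W2 W2sqxx sqrtr0. Qed.

Lemma W2sqE mu nu : (W2sq mu nu < +oo)%E -> W2sq mu nu = (W2 mu nu ^+ 2)%:E.
Proof.
move=> fin; rewrite sqr_sqrtr ?fine_ge0 ?W2sq_ge0// fineK//.
by rewrite ge0_fin_numE ?W2sq_ge0.
Qed.

Lemma P2_W2sqE w0 mu nu : P2 w0 mu -> P2 w0 nu -> W2sq mu nu = (W2 mu nu ^+ 2)%:E.
Proof.
move=> mu2 nu2; apply: W2sqE; apply: (W2sq_lty_trans w0) => //.
by rewrite W2sqC.
Qed.

Lemma P2_of_W2sq_lty w0 mu nu : P2 w0 mu -> (W2sq mu nu < +oo)%E -> P2 w0 nu.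
Proof. by move=> mu2 fin; apply: (W2sq_lty_trans mu) => //; rewrite W2sqC. Qed.

Let m11 : measurable_fun setT (fun z : (Rd R d * Rd R d) * Rd R d => z.1.1).
Proof. by apply: (measurableT_comp measurable_fst). Qed.
Let m12 : measurable_fun setT (fun z : (Rd R d * Rd R d) * Rd R d => z.1.2).
Proof. by apply: (measurableT_comp measurable_snd). Qed.
Let m13 : measurable_fun setT (fun z : (Rd R d * Rd R d) * Rd R d => (z.1.1, z.2)).
Proof. exact: measurable_fun_pair. Qed.
Let msq : measurable_fun setT (fun z : Rd R d * Rd R d => (sqdist z.1 z.2)%:E).
Proof. by apply/measurable_EFinP; exact: measurable_sqdist. Qed.

Lemma transport_plan_marginals om mu0 mu1 p : transport_plan om mu0 mu1 p ->
  [/\ forall A, measurable A -> om A = p ((fun z => z.1.1) @^-1` A),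
      forall A, measurable A -> mu0 A = p ((fun z => z.1.2) @^-1` A) &
      forall A, measurable A -> mu1 A = p (snd @^-1` A)].
Proof.
move=> [[g [[[g1 g2] _] gE]] [g' [[[g'1 g'2] _] g'E]]]; split => A mA.
- by rewrite -g1// gE// -[X in measurable X]setTI; exact: measurable_fst.
- by rewrite -g2// gE// -[X in measurable X]setTI; exact: measurable_snd.
- by rewrite -g'2// g'E// -[X in measurable X]setTI; exact: measurable_snd.
Qed.

Lemma transport_plan_cost om mu0 mu1 p : transport_plan om mu0 mu1 p ->
  (\int[p]_z (sqdist z.1.1 z.1.2)%:E = W2sq om mu0)%E /\
  (\int[p]_z (sqdist z.1.1 z.2)%:E = W2sq om mu1)%E.
Proof.
have sq0 (z : Rd R d * Rd R d) : (0 <= (sqdist z.1 z.2)%:E)%E by rewrite lee_fin sqdist_ge0.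
move=> [[g [[_ gc] gE]] [g' [[_ g'c] g'E]]]; split.
  by rewrite -gc /cost (integral_marginal p g fst _ _ gE msq sq0).
by rewrite -g'c /cost (integral_marginal p g' _ _ m13 g'E msq sq0).
Qed.

Lemma W2sq_le_W2plan om mu0 mu1 p : transport_plan om mu0 mu1 p ->
  (W2sq mu0 mu1 <= W2plan_sq p)%E.
Proof. by move=> /transport_plan_marginals[_ p2 p3]; exact: W2sq_le. Qed.

Lemma W2plan_ge0 (p : probability ((Rd R d * Rd R d) * Rd R d)%type R) :
  (0 <= W2plan_sq p)%E.
Proof. by apply: integral_ge0 => z _; rewrite lee_fin sqdist_ge0. Qed.

Lemma W2plan_young om mu0 mu1 p t : transport_plan om mu0 mu1 p -> 0 < t ->
  (W2plan_sq p <= (1 + t)%:E * W2sq om mu0 + (1 + t^-1)%:E * W2sq om mu1)%E.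
Proof.
move=> pP t0; have ti0 : 0 < t^-1 by rewrite invr_gt0.
have [<- <-] := transport_plan_cost _ _ _ _ pP.
rewrite -ge0_integral_lincomb; [|lra|lra|by move=> z; exact: sqdist_ge0..|
  exact: measurable_sqdist|exact: measurable_sqdist].
apply: ge0_le_integral => //.
- by move=> z _; rewrite lee_fin sqdist_ge0.
- by apply/measurable_EFinP; exact: measurable_sqdist.
- apply/measurable_EFinP; apply: measurable_funD; apply: measurable_funM => //;
    exact: measurable_sqdist.
- by move=> z _; rewrite lee_fin; exact: sqdist_young.
Qed.

(** The lower bound holds because the plan couples [mu0] and [mu1], the upper one by optimizing
    [W2plan_young] over [t]. Together they contain the triangle inequality through [om]. *)
Lemma W2plan_le w0 om mu0 mu1 p : P2 w0 om -> P2 w0 mu0 -> P2 w0 mu1 ->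
  transport_plan om mu0 mu1 p ->
  exists2 c, W2plan_sq p = c%:E & W2 mu0 mu1 ^+ 2 <= c <= (W2 om mu0 + W2 om mu1) ^+ 2.
Proof.
move=> om2 mu02 mu12 pP.
have yng t : 0 < t ->
    (W2plan_sq p <= ((1 + t) * W2 om mu0 ^+ 2 + (1 + t^-1) * W2 om mu1 ^+ 2)%:E)%E.
  move=> t0; apply: le_trans (W2plan_young _ _ _ _ t pP t0) _.
  by rewrite (P2_W2sqE w0 om mu0)// (P2_W2sqE w0 om mu1).
have fin : W2plan_sq p \is a fin_num.
  by rewrite ge0_fin_numE ?W2plan_ge0// (le_lt_trans (yng _ ltr01))// ltry.
exists (fine (W2plan_sq p)); first by rewrite fineK.
rewrite -lee_fin fineK// -(P2_W2sqE w0)// (W2sq_le_W2plan _ _ _ _ pP)/=.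
apply: le_sqrD_of_young; rewrite ?W2_ge0// => t t0.
by rewrite -lee_fin fineK// yng.
Qed.

Lemma exists_gen_geodesic_point (p : probability ((Rd R d * Rd R d) * Rd R d)%type R) a :
  exists nu, is_gen_geodesic_point p a nu.
Proof. by apply: pushforward_probability; exact: measurable_lincomb. Qed.

(** The integral of [sqdist_lincomb] against [p]; only the term in [nu] becomes an inequality, since
    [p] need not couple [om] and [nu] optimally. *)
Lemma W2sq_gen_geodesic om mu0 mu1 p a nu : transport_plan om mu0 mu1 p ->
  is_gen_geodesic_point p a nu -> 0 <= a <= 1 ->
  (W2sq om nu + (a * (1 - a))%:E * W2plan_sq p <=
   (1 - a)%:E * W2sq om mu0 + a%:E * W2sq om mu1)%E.
Proof.
move=> pP nuP /andP[a0 a1].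
have [p1 p2 p3] := transport_plan_marginals _ _ _ _ pP.
have mlc : measurable_fun setT
    (fun z : (Rd R d * Rd R d) * Rd R d => lincomb a z.1.2 z.2).
  exact: measurable_lincomb.
have a10 : 0 <= 1 - a by lra.
have aa : 0 <= a * (1 - a) by exact: mulr_ge0.
have [<- <-] := transport_plan_cost _ _ _ _ pP.
rewrite -ge0_integral_lincomb//; [|by move=> z; exact: sqdist_ge0..|
  exact: measurable_sqdist|exact: measurable_sqdist].
under [leRHS]eq_integral do rewrite -sqdist_lincomb -[X in (X + _)%:E]mul1r.
rewrite ge0_integral_lincomb//; [|by move=> z; exact: sqdist_ge0..|
  exact: measurable_sqdist|exact: measurable_sqdist].
by rewrite mul1e; apply: leeD2r; exact: W2sq_le.
Qed.

(** Keeps the geodesic at finite distance from [mu0], and controls its speed in the slope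
    estimate. *)
Lemma W2sq_gen_geodesic_start om mu0 mu1 p a nu : transport_plan om mu0 mu1 p ->
  is_gen_geodesic_point p a nu -> (W2sq mu0 nu <= (a ^+ 2)%:E * W2plan_sq p)%E.
Proof.
move=> pP nuP; have [p1 p2 p3] := transport_plan_marginals _ _ _ _ pP.
rewrite -ge0_integralZl_EFin ?sqr_ge0//; last 2 first.
- by move=> z _; rewrite lee_fin sqdist_ge0.
- by apply/measurable_EFinP; exact: measurable_sqdist.
under eq_integral do rewrite -EFinM -sqdist_lincombl.
by apply: W2sq_le => //; exact: measurable_lincomb.
Qed.

End Plans.

(** Replaces the limit [a -> 0]: if [D < X], then [a = (X - D) / (2 * X)] makes the left side the
    midpoint of [D] and [X]. The case [a = 1] gives [0 <= D], so this [a] is admissible. *)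
Lemma le_of_shrink_le {R : realType} (X D : R) : 0 <= X ->
  (forall a, 0 < a <= 1 -> (1 - a) * X <= D) -> X <= D.
Proof.
move=> X0 HX; rewrite leNgt; apply/negP => DX.
have D0 : 0 <= D by have := HX 1; rewrite subrr mul0r ltr01 lexx; apply.
have Xp : 0 < X by lra.
have a0 : 0 < (X - D) / (2 * X) by apply: divr_gt0; lra.
have a1 : (X - D) / (2 * X) <= 1 by rewrite ler_pdivrMr; lra.
have := HX ((X - D) / (2 * X)); rewrite a0 a1 => /(_ isT).
have -> : (1 - (X - D) / (2 * X)) * X = (X + D) / 2 by field; rewrite gt_eqF.
lra.
Qed.

Definition finite_energy {R : realType} {d : nat} (w : probability (Rd R d) R)
    (E : probability (Rd R d) R -> \bar R) (mu : probability (Rd R d) R) : Prop :=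
  P2 w mu /\ (E mu < +oo)%E.

(** * One minimizing step: variational inequality and slope *)

Section MinimizingMovement.
Context {R : realType} {d : nat} (w : probability (Rd R d) R).
Context (E : probability (Rd R d) R -> \bar R) (lam : R).
Hypothesis Efin : no_minus_infty w E.
Hypothesis Elsc : W2_lsc w E.
Hypothesis Econv : convex_gen_geod w E lam.

Local Notation dom := (finite_energy w E).
Local Notation l := (lam_minus lam).
Local Notation Er mu := (fine (E mu)).

Lemma energyK mu : dom mu -> E mu = (Er mu)%:E.
Proof. by move=> [mu2 mufin]; rewrite fineK// fin_numE Efin// lt_eqF. Qed.

Lemma W2_triangle om mu0 mu1 : P2 w om -> P2 w mu0 -> P2 w mu1 ->
  W2 mu0 mu1 <= W2 mu0 om + W2 om mu1.
Proof.
move=> om2 mu02 mu12; have [p [pP _]] := Econv mu0 mu1 om mu02 mu12 om2.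
have [c _ /andP[c1 c2]] := W2plan_le w om mu0 mu1 p om2 mu02 mu12 pP.
rewrite (W2C mu0 om) -ler_sqr ?nnegrE ?addr_ge0 ?W2_ge0//.
exact: le_trans c1 c2.
Qed.

(** Moves all later arguments to real numbers. Here [c] is the cost of the plan, the same for every
    [a]. *)
Lemma gen_geodesic_bounds om mu0 mu1 : P2 w om -> dom mu0 -> dom mu1 ->
  exists2 c, W2 mu0 mu1 ^+ 2 <= c <= (W2 om mu0 + W2 om mu1) ^+ 2 &
  forall a, 0 <= a <= 1 -> exists nu, [/\ dom nu,
    Er nu <= (1 - a) * Er mu0 + a * Er mu1 - a * (1 - a) * lam / 2 * c,
    W2 om nu ^+ 2 + a * (1 - a) * c <= (1 - a) * W2 om mu0 ^+ 2 + a * W2 om mu1 ^+ 2 &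
    W2 mu0 nu ^+ 2 <= a ^+ 2 * c].
Proof.
move=> om2 D0 D1; have [mu02 _] := D0; have [mu12 _] := D1.
have [p [pP pE]] := Econv mu0 mu1 om mu02 mu12 om2.
have [c cE cb] := W2plan_le w om mu0 mu1 p om2 mu02 mu12 pP.
exists c => // a a01; have [nu nuP] := exists_gen_geodesic_point p a.
have := W2sq_gen_geodesic_start om mu0 mu1 p a nu pP nuP; rewrite cE -EFinM => nu0.
have nu2 : P2 w nu by apply: (P2_of_W2sq_lty w mu0) => //; rewrite (le_lt_trans nu0)// ltry.
have Enu : (E nu <= ((1 - a) * Er mu0 + a * Er mu1 - a * (1 - a) * lam / 2 * c)%:E)%E.
  by have := pE a a01 nu nuP; rewrite cE (energyK _ D0) (energyK _ D1).
have Dnu : dom nu by split=> //; rewrite (le_lt_trans Enu)// ltry.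
exists nu; split => //.
- by rewrite -lee_fin -energyK.
- have := W2sq_gen_geodesic om mu0 mu1 p a nu pP nuP a01.
  by rewrite cE !(P2_W2sqE w om)// -!EFinM -!EFinD lee_fin.
- by rewrite -lee_fin -(P2_W2sqE w).
Qed.

Lemma JKO_step_dom tau mu nu om : 0 < tau -> P2 w mu -> dom om ->
  is_JKO_step w E tau mu nu -> dom nu.
Proof.
move=> tau0 mu2 Dom [nu2 numin]; split=> //.
have := numin om Dom.1; rewrite (energyK _ Dom) !(P2_W2sqE w mu)//; last exact: Dom.1.
by rewrite -!EFinM -EFinD; case: (E nu) => [r _||_]; rewrite ?ltry ?addey ?leye_eq.
Qed.

(** Minimality compares [nu] with the point at parameter [a] of the geodesic from [nu] to [om] with
    base [mu]; one divides by [a] and lets [a] tend to 0. The distance contributes [c] and the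
    energy [lam * tau * c] to the convexity term. *)
Lemma JKO_step_variational tau mu nu om : 0 < tau -> l * tau < 1 ->
  P2 w mu -> dom nu -> dom om -> is_JKO_step w E tau mu nu ->
  (1 - l * tau) * W2 nu om ^+ 2 <=
  W2 mu om ^+ 2 - W2 mu nu ^+ 2 + 2 * tau * (Er om - Er nu).
Proof.
move=> tau0 ltau mu2 Dnu Dom [nu2 numin].
have [c /andP[c1 _] geod] := gen_geodesic_bounds mu nu om mu2 Dnu Dom.
have W0 := sqr_ge0 (W2 nu om).
have l1 : 1 - l * tau <= 1 + lam * tau.
  by have := ge_lam_minus lam; nra.
apply: (@le_trans _ _ ((1 + lam * tau) * c)).
  by apply: (@le_trans _ _ ((1 - l * tau) * c)); [apply: ler_wpM2l|apply: ler_wpM2r]; lra.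
apply: le_of_shrink_le => [|a /andP[a0 a1]]; first by apply: mulr_ge0; lra.
have [|va [Dva Eva Wva _]] := geod a; first by rewrite ltW.
have := numin va Dva.1.
rewrite (energyK _ Dva) (energyK _ Dnu) !(P2_W2sqE w mu)//; last exact: Dva.1.
rewrite -!EFinM -!EFinD lee_fin => numin'.
have tE x y : (2 * tau)^-1 * x + y = (2 * tau)^-1 * (x + 2 * tau * y).
  by field; rewrite gt_eqF.
move: numin'; rewrite !tE ler_pM2l ?invr_gt0; last by lra.
move=> numin'.
rewrite -(ler_pM2l a0).
have := ler_wpM2l (ltW tau0) Eva.
nra.
Qed.

(** Lower semicontinuity along a constant sequence. This settles the degenerate cases in which one
    cannot divide by [W2]. *)
Lemma energy_le_of_W2_eq0 mu nu : P2 w mu -> P2 w nu -> W2 nu mu = 0 -> (E mu <= E nu)%E.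
Proof.
move=> mu2 nu2 W0; have := Elsc (fun=> nu) mu mu2 (fun=> nu2).
rewrite W0 (cvg_limn_einf_sup (cvg_cst (E nu))).1; apply; exact: cvg_cst.
Qed.

(** If some punctured ball around [mu] is empty, the supremum over it, hence [slope], is [-oo].
    Finiteness excludes this, and the remaining suprema are over nonempty sets of nonnegative
    quotients. *)
Lemma slope_fin_ge0 mu : slope w E mu \is a fin_num -> (0 <= slope w E mu)%E.
Proof.
move=> sfin; apply: le_ereal_inf_tmp => _ [delta /= delta0 <-].
set A := (X in ereal_sup X); have [A0|/set0P[_ [nu [nu2 /andP[W0 Wd]] _]]] := eqVneq A set0.
  have : (slope w E mu <= -oo)%E.
    have <- : ereal_sup A = -oo%E by rewrite A0 ereal_sup0.
    by apply: ereal_inf_lbound; exists delta.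
  by rewrite leeNy_eq => /eqP e; rewrite e in sfin.
apply: (@le_trans _ _ (Order.max (E mu - E nu) 0%E * (W2 mu nu)^-1%:E)%E).
  by apply: mule_ge0; rewrite ?le_max ?lexx ?orbT// lee_fin invr_ge0 W2_ge0.
by apply: ereal_sup_ubound; exists nu => //; split => //; rewrite W0.
Qed.

(* [E] decreases at rate at most [s] from [mu], up to the semiconvexity defect;
   this is the global form of [|dE|(mu) <= s]. *)
Definition slope_bound (s : R) (mu : probability (Rd R d) R) :=
  forall v, dom v -> Er mu - Er v <= s * W2 mu v + l / 2 * W2 mu v ^+ 2.

(** On the geodesic from [mu] to [v] with base [mu], parameter [a] lies within [a * W2 mu v] of [mu]
    and lowers the energy by at least [a * D]. So quotients of at least [D / W2 mu v] occur at
    arbitrarily small distance. *)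
Lemma slope_slope_bound mu : dom mu -> slope w E mu \is a fin_num ->
  slope_bound (fine (slope w E mu)) mu.
Proof.
move=> Dmu sfin v Dv.
have s0 : 0 <= fine (slope w E mu) by rewrite fine_ge0 ?slope_fin_ge0.
have l0 := lam_minus_ge0 lam.
have := W2_ge0 mu v; rewrite le_eqVlt => /predU1P[W0|W0].
  rewrite -W0 mulr0 expr0n mulr0 addr0 subr_le0 -lee_fin -!energyK//.
  by apply: energy_le_of_W2_eq0; [exact: Dmu.1|exact: Dv.1|rewrite W2C -W0].
rewrite -lerBlDr; set D := (X in X <= _).
have [D0|D0] := leP D 0; first by apply: (le_trans D0); rewrite mulr_ge0 ?W2_ge0.
rewrite -ler_pdivrMr// -lee_fin fineK//.
apply: le_ereal_inf_tmp => _ [delta /= delta0 <-].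
have [c /andP[c1 c2] geod] := gen_geodesic_bounds mu mu v Dmu.1 Dmu Dv.
rewrite W2xx add0r in c2.
pose a := Num.min 1 (delta / (2 * W2 mu v)).
have a0 : 0 < a by rewrite /a lt_min ltr01 divr_gt0// mulr_gt0.
have a1 : a <= 1 by rewrite /a ge_min lexx.
have aW : a * W2 mu v < delta.
  have : a * (2 * W2 mu v) <= delta by rewrite -ler_pdivlMr ?mulr_gt0// /a ge_min lexx orbT.
  lra.
have [|nu [Dnu Enu _ Wnu]] := geod a; first by rewrite ltW.
have {}Wnu : W2 mu nu <= a * W2 mu v.
  rewrite -ler_sqr ?nnegrE ?mulr_ge0 ?W2_ge0 ?(ltW a0)// exprMn.
  by apply: (le_trans Wnu); apply: ler_wpM2l => //; exact: sqr_ge0.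
have c0 : 0 <= c by apply: le_trans c1; exact: sqr_ge0.
have drop : a * D <= Er mu - Er nu.
  have h1 : (1 - a) * c * - l <= (1 - a) * c * lam.
    by apply: ler_wpM2l; [apply: mulr_ge0; lra|exact: ge_lam_minus].
  have h2 : (1 - a) * c * l <= W2 mu v ^+ 2 * l by apply: ler_wpM2r => //; nra.
  have : a * ((1 - a) * c * lam + W2 mu v ^+ 2 * l) >= 0 by apply: mulr_ge0; lra.
  rewrite /D; move: Enu; lra.
have aD : 0 < a * D by exact: mulr_gt0.
(* At distance 0 the energy could not drop, contradicting [aD]. *)
have /predU1P[Wnu0|Wnu0] : (0 == W2 mu nu) || (0 < W2 mu nu) by rewrite -le_eqVlt W2_ge0.
  have : (E mu <= E nu)%E.
    by apply: energy_le_of_W2_eq0; [exact: Dmu.1|exact: Dnu.1|rewrite W2C -Wnu0].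
  by rewrite (energyK _ Dmu) (energyK _ Dnu) lee_fin => Emn; exfalso; lra.
apply: ereal_sup_ge => /=.
exists (Order.max (E mu - E nu) 0%E * (W2 mu nu)^-1%:E)%E.
  by exists nu => //; split; [exact: Dnu.1|rewrite Wnu0 (le_lt_trans Wnu)].
rewrite (energyK _ Dmu) (energyK _ Dnu) -EFinB.
apply: (@le_trans _ _ ((Er mu - Er nu)%:E * (W2 mu nu)^-1%:E)%E); last first.
  by apply: lee_wpmul2r; rewrite ?lee_fin ?invr_ge0 ?W2_ge0// le_max lexx.
rewrite -EFinM lee_fin ler_pdivlMr// mulrAC ler_pdivrMr//.
apply: (@le_trans _ _ (D * (a * W2 mu v))); first by apply: ler_wpM2l => //; lra.
by rewrite mulrA; apply: ler_wpM2r; [exact: W2_ge0|lra].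
Qed.

(** Testing the variational inequality at [mu] itself bounds the step length by
    [h * s / (1 - l * h)]. Testing it at [v] and expanding the squared triangle inequality bounds
    the slope at [nu] by step length over [h]. *)
Lemma JKO_step_slope_bound h s mu nu : 0 < h -> l * h < 1 -> 0 <= s ->
  dom mu -> dom nu -> is_JKO_step w E h mu nu ->
  slope_bound s mu -> slope_bound (s / (1 - l * h)) nu.
Proof.
move=> h0 lh s0 Dmu Dnu J Smu v Dv.
have [y0 z0] : 0 <= W2 mu nu /\ 0 <= W2 nu v by split; exact: W2_ge0.
have Wle : W2 mu nu <= h * (s / (1 - l * h)).
  have := JKO_step_variational h mu nu mu h0 lh Dmu.1 Dnu Dmu J.
  rewrite W2xx (W2C nu mu) expr0n/= => V.
  have S := Smu nu Dnu.
  move: y0; rewrite le_eqVlt => /predU1P[<-|y0].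
    by rewrite mulr_ge0 ?divr_ge0//; lra.
  rewrite mulrA ler_pdivlMr; last by lra.
  rewrite -(ler_pM2l y0).
  have := ler_wpM2l (ltW h0) S; nra.
have V := JKO_step_variational h mu nu v h0 lh Dmu.1 Dnu Dv J.
have T := W2_triangle nu mu v Dnu.1 Dmu.1 Dv.1.
have T2 : W2 mu v ^+ 2 <= (W2 mu nu + W2 nu v) ^+ 2.
  by rewrite ler_sqr ?nnegrE ?addr_ge0 ?W2_ge0.
have Wz : W2 mu nu * W2 nu v <= h * (s / (1 - l * h)) * W2 nu v by exact: ler_wpM2r.
rewrite -(ler_pM2l h0); nra.
Qed.

End MinimizingMovement.

(* [a], [b], [c], [x], [y] stand for the distances [W2] between the pairs
   (J^(n-1), J^(m-1)), (J^(n-1), J^n), (J^n, J^(m-1)), (J^n, J^m), (J^(m-1), J^m);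
   [1 - l h] times the first variational inequality plus [h / t] times the second
   produces the coefficient [(t - h) / t] exactly. *)
Lemma recursive_inequality_arith {R : realType} (h t l s a b c x y eA eB eB' : R) :
  0 < h -> h <= t -> 0 <= l -> l * t < 1 -> 0 <= s ->
  0 <= a -> 0 <= b -> 0 <= c -> c <= b + a ->
  (1 - l * h) * x ^+ 2 <= c ^+ 2 - y ^+ 2 + 2 * h * (eA - eB) ->
  (1 - l * t) * c ^+ 2 <= a ^+ 2 - b ^+ 2 + 2 * t * (eB' - eA) ->
  eB' - eB <= s * y + l / 2 * y ^+ 2 ->
  eB' - eA <= s * c + l / 2 * c ^+ 2 ->
  (1 - l * h) ^+ 2 * x ^+ 2 <= h / t / (1 - l * t) * a ^+ 2
    + (t - h) / t * c ^+ 2 + 2 * h ^+ 2 * (s / (1 - l * h)) ^+ 2.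
Proof.
move=> h0 ht l0 lt1 s0 a0 b0 c0 cab H1 H2 H3 H4.
have t0 : 0 < t by lra.
have lh1 : l * h < 1 by apply: le_lt_trans lt1; exact: ler_wpM2l.
set q := 1 - l * h in H1 *; set r := 1 - l * t in H2 *.
have q0 : 0 < q by rewrite /q; lra.
have r0 : 0 < r by rewrite /r; lra.
have lh0 : 0 <= l * h by rewrite mulr_ge0// ltW.
have q1 : q <= 1 by rewrite /q; lra.
(* [L1] spends [h ^+ 2 * s ^+ 2] of the allowed error. [L3], multiplied by [h], spends the rest and
   leaves [h * l * c ^+ 2]. [L2] pays for that with the term in [b] from [H2] and the excess of
   [(1 - l * t)^-1] over 1. *)
have L1 : q * (2 * h * (s * y + l / 2 * y ^+ 2) - y ^+ 2) <= h ^+ 2 * s ^+ 2.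
  by have := sqr_ge0 (q * y - h * s); rewrite /q; lra.
have L2 : l * c ^+ 2 <= b ^+ 2 / t + l / r * a ^+ 2.
  have -> : b ^+ 2 / t + l / r * a ^+ 2 = (r * b ^+ 2 + l * t * a ^+ 2) / (t * r).
    by field; rewrite !gt_eqF.
  rewrite ler_pdivlMr; last exact: mulr_gt0.
  have cab2 : c ^+ 2 <= (b + a) ^+ 2 by rewrite ler_sqr ?nnegrE ?addr_ge0.
  have ltr0 : 0 <= l * t * r by rewrite !mulr_ge0// ltW.
  have := ler_wpM2l ltr0 cab2; have := sqr_ge0 (l * t * a - r * b); rewrite /r; lra.
have L3 : 2 * l * h * (s * c + l / 2 * c ^+ 2) <=
    l * c ^+ 2 + 2 * h * (s / q) ^+ 2 - h * s ^+ 2.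
  rewrite -subr_ge0.
  have -> : l * c ^+ 2 + 2 * h * (s / q) ^+ 2 - h * s ^+ 2 - 2 * l * h * (s * c + l / 2 * c ^+ 2) =
    l / q * (q * c - h * s) ^+ 2 + h * s ^+ 2 * (2 - q) / q ^+ 2.
    by rewrite /q; field; rewrite gt_eqF.
  apply: addr_ge0; first by rewrite mulr_ge0 ?sqr_ge0// divr_ge0// ltW.
  apply: divr_ge0; last exact: sqr_ge0.
  by apply: mulr_ge0; [rewrite mulr_ge0 ?sqr_ge0// ltW|lra].
have M1 := ler_wpM2l (ltW q0) H1.
have M2 := ler_wpM2l (divr_ge0 (ltW h0) (ltW t0)) H2.
have M3 : 2 * h * q * (eB' - eB) <= 2 * h * q * (s * y + l / 2 * y ^+ 2).
  by apply: ler_wpM2l => //; rewrite !mulr_ge0// ltW.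
have M4 : 2 * h * (l * h) * (eB' - eA) <= 2 * h * (l * h) * (s * c + l / 2 * c ^+ 2).
  by apply: ler_wpM2l => //; rewrite !mulr_ge0// ltW.
have N2 := ler_wpM2l (ltW h0) L2.
have N3 := ler_wpM2l (ltW h0) L3.
have e1 : h / t * (a ^+ 2 - b ^+ 2 + 2 * t * (eB' - eA)) =
  h / t * a ^+ 2 - h / t * b ^+ 2 + 2 * h * (eB' - eA) by field; rewrite gt_eqF.
have e2 : h / t / r * a ^+ 2 = h / t * a ^+ 2 + h * (l / r * a ^+ 2).
  by rewrite /r; field; rewrite !gt_eqF.
have e3 : (t - h) / t * c ^+ 2 = q * c ^+ 2 - h / t * (r * c ^+ 2).
  by rewrite /q /r; field; rewrite !gt_eqF.
have e4 : h * (b ^+ 2 / t + l / r * a ^+ 2) = h / t * b ^+ 2 + h * (l / r * a ^+ 2).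
  by field; rewrite !gt_eqF.
rewrite e2 e3; rewrite e1 in M2; rewrite e4 in N2.
have e5 : q * (eA - eB) + (eB' - eA) = q * (eB' - eB) + l * h * (eB' - eA) by rewrite /q; ring.
have := congr1 (fun z => 2 * h * z) e5.
lra.
Qed.

(** * Iterated steps and the recursive inequality *)

Section Iterates.
Context {R : realType} {d : nat} (w : probability (Rd R d) R).
Context (E : probability (Rd R d) R -> \bar R) (lam : R).
Hypothesis Efin : no_minus_infty w E.
Hypothesis Econv : convex_gen_geod w E lam.
Variables (h : nat -> R) (J : nat -> probability (Rd R d) R).
Hypothesis h0 : forall k, 0 < h k.+1.
Hypothesis J0 : finite_energy w E (J 0).
Hypothesis HJ : forall k, is_JKO_step w E (h k.+1) (J k) (J k.+1).

Lemma iterates_finite_energy k : finite_energy w E (J k).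
Proof.
elim: k => // k IH; have [Jk _] := IH.
exact: (JKO_step_dom w E Efin (h k.+1) (J k) _ (J k)).
Qed.

Lemma iterates_slope_bound s k : (forall i, lam_minus lam * h i.+1 < 1) -> 0 <= s ->
  slope_bound w E lam s (J 0) ->
  slope_bound w E lam (s * \prod_(1 <= i < k.+1) (1 - lam_minus lam * h i)^-1) (J k).
Proof.
move=> lh s0 S0; elim: k => [|k IH]; first by rewrite big_geq// mulr1.
rewrite big_nat_recr//= mulrA.
apply: (JKO_step_slope_bound w E lam Efin Econv (h k.+1) _ (J k)) => //.
- rewrite mulr_ge0//; elim: k {IH} => [|k IH]; first by rewrite big_geq.
  by rewrite big_nat_recr//= mulr_ge0// invr_ge0 subr_ge0 ltW.
- exact: iterates_finite_energy.
- exact: iterates_finite_energy.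
Qed.

End Iterates.

Theorem theoremA1 (R : realType) (d : nat) (w0 : probability (Rd R d) R)
  (E : probability (Rd R d) R -> \bar R) (lam : R)
  (HE : no_minus_infty w0 E) (Hprop : E_proper w0 E) (Hcoer : coercive w0 E)
  (Hlsc : W2_lsc w0 E) (Hconv : convex_gen_geod w0 E lam)
  (mu : probability (Rd R d) R) (Hmu : in_dom_slope w0 E mu)
  (h : nat -> R) (tau : R)
  (Hh : forall i, (1 <= i)%N -> 0 < h i <= tau)
  (Htau : lam_minus lam * tau < 1)
  (Jh Jt : nat -> probability (Rd R d) R)
  (HJh0 : Jh 0%N = mu) (HJh : forall m, is_JKO_step w0 E (h m.+1) (Jh m) (Jh m.+1))
  (HJt0 : Jt 0%N = mu) (HJt : forall k, is_JKO_step w0 E tau (Jt k) (Jt k.+1))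
  (n m : nat) :
  let P := \prod_(1 <= k < m.+2) (1 - lam_minus lam * h k)^-1 in
  (((1 - lam_minus lam * h m.+1) ^+ 2)%:E * W2sq (Jt n.+1) (Jh m.+1)
   <= (h m.+1 / tau / (1 - lam_minus lam * tau))%:E * W2sq (Jt n) (Jh m)
      + ((tau - h m.+1) / tau)%:E * W2sq (Jh m) (Jt n.+1)
      + (2 * h m.+1 ^+ 2 * P ^+ 2)%:E * (slope w0 E mu * slope w0 E mu))%E.
Proof.
cbv zeta; set P := (\prod_(1 <= k < m.+2) _); have [mu2 [mufin slopefin]] := Hmu.
have l0 := lam_minus_ge0 lam.
have h0 k : 0 < h k.+1 by have /andP[] := Hh k.+1 isT.
have ht k : h k.+1 <= tau by have /andP[] := Hh k.+1 isT.
have lh k : lam_minus lam * h k.+1 < 1 by apply: le_lt_trans Htau; exact: ler_wpM2l.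
have t0 : 0 < tau by exact: lt_le_trans (h0 0%N) (ht 0%N).
have Dmu : finite_energy w0 E mu by [].
have DJh k : finite_energy w0 E (Jh k).
  by apply: (iterates_finite_energy w0 E HE h) => //; rewrite HJh0.
have DJt k : finite_energy w0 E (Jt k).
  by apply: (iterates_finite_energy w0 E HE (fun=> tau)) => //; rewrite HJt0.
have WE mu' nu' : finite_energy w0 E mu' -> finite_energy w0 E nu' ->
    W2sq mu' nu' = (W2 mu' nu' ^+ 2)%:E.
  by move=> [? _] [? _]; exact: (P2_W2sqE w0).
rewrite !WE//.
have P0 : 0 < P.
  by rewrite /P big_nat_cond; apply: prodr_gt0 => -[|k]//= _; rewrite invr_gt0 subr_gt0.
(* The only infinite value left is [-oo], whose square is [+oo]; since [K0] makes the coefficient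
   positive, the right-hand side is then [+oo]. *)
have [sfin|] := boolP (slope w0 E mu \is a fin_num); last first.
  have K0 : 0 < 2 * h m.+1 ^+ 2 * P ^+ 2 by rewrite !mulr_gt0// exprn_gt0.
  rewrite fin_numE negb_and !negbK (lt_eqF slopefin) orbF => /eqP ->.
  by rewrite mulNyNy gt0_muley ?lte_fin// -!EFinM -EFinD addey// leey.
set S := fine (slope w0 E mu); have SE : slope w0 E mu = S%:E by rewrite fineK.
have S0 : 0 <= S by rewrite fine_ge0 ?slope_fin_ge0.
rewrite SE -!EFinM -!EFinD lee_fin.
(* The slope bound is used one step earlier, at [Jh m]; the last factor of [P] is the division by
   [1 - l * h] in the arithmetic lemma. *)
set Q := \prod_(1 <= k < m.+1) (1 - lam_minus lam * h k)^-1.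
have PE : P = Q / (1 - lam_minus lam * h m.+1) by rewrite /P big_nat_recr.
have Q0 : 0 <= Q.
  by rewrite /Q big_nat_cond; apply: prodr_ge0 => -[|k]//= _; rewrite invr_ge0 subr_ge0 ltW.
have SB : slope_bound w0 E lam (S * Q) (Jh m).
  apply: (iterates_slope_bound w0 E lam HE Hconv h) => //; rewrite HJh0//.
  exact: slope_slope_bound.
have -> : 2 * h m.+1 ^+ 2 * P ^+ 2 * (S * S) =
    2 * h m.+1 ^+ 2 * (S * Q / (1 - lam_minus lam * h m.+1)) ^+ 2 by rewrite PE; ring.
apply: (recursive_inequality_arith _ _ _ _ _ (W2 (Jt n) (Jt n.+1)) _ _ (W2 (Jh m) (Jh m.+1))
  (fine (E (Jt n.+1))) (fine (E (Jh m.+1))) (fine (E (Jh m)))) => //.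
- exact: mulr_ge0.
- exact: W2_ge0.
- exact: W2_ge0.
- exact: W2_ge0.
- rewrite (W2C (Jh m)) (W2C (Jt n) (Jt n.+1)).
  apply: (W2_triangle w0 E lam Hconv); [exact: (DJt _).1|exact: (DJt _).1|exact: (DJh _).1].
- rewrite (W2C (Jt n.+1)).
  by apply: (JKO_step_variational w0 E lam HE Hconv) => //; exact: (DJh _).1.
- rewrite (W2C (Jh m)).
  by apply: (JKO_step_variational w0 E lam HE Hconv) => //; exact: (DJt _).1.
- exact: SB.
- exact: SB.
Qed.
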